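(* Let $R$ be a commutative ring and $\ell\in\mathbb{N}$. Then $R$ is of Krull dimension $\le\ell-1$ if and only if for any sequence $x_1,\ldots,x_\ell$ in $R$ there exist $a_1,\ldots,a_\ell\in R$ and $m_1,\ldots,m_\ell\in\mathbb{N}$ such that $$x_1^{m_1}\bigl(\cdots\bigl(x_\ell^{m_\ell}(1+a_\ell x_\ell)+\cdots\bigr)+a_1x_1\bigr)=0.$$ Precisely, the left-hand side is $t_1$, where $t_{\ell+1}=1$ and $t_k=x_k^{m_k}(t_{k+1}+a_kx_k)$ for $k=\ell,\ldots,1$ (for $\ell=0$ the condition reads $1=0$ in $R$).
   Context: Krull dimension is defined without reference to prime ideals, as follows. The Zariski lattice $\mathrm{Zar}(R)$ is the distributive lattice whose elements are the radicals of finitely generated ideals of $R$, ordered by inclusion, with $\sqrt{I_1}\wedge\sqrt{I_2}=\sqrt{I_1I_2}$ and $\sqrt{I_1}\vee\sqrt{I_2}=\sqrt{I_1+I_2}$. For a distributive lattice $L$ (with $0$ and $1$), $\mathrm{Kr}_\ell(L)$ is the distributive lattice presented by generators $\varphi_i(x)$ for $0\le i\le\ell$, $x\in L$ (that is, $\ell+1$ disjoint copies of $L$), and the relations (where $A\vdash B$ stands for $\bigwedge A\le\bigvee B$): $\vdash\varphi_i(1)$; $\varphi_i(0)\vdash$; $\varphi_i(a),\varphi_i(b)\vdash\varphi_i(a\wedge b)$; $\varphi_i(a\vee b)\vdash\varphi_i(a),\varphi_i(b)$; $\varphi_i(a)\vdash\varphi_i(b)$ whenever $a\le b$ in $L$;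 $\varphi_{i+1}(a)\vdash\varphi_i(a)$ for $i<\ell$. The lattice $L$ is of dimension $\le\ell-1$ if for all $x_1,\ldots,x_\ell\in L$ one has $\varphi_0(x_1)\wedge\cdots\wedge\varphi_{\ell-1}(x_\ell)\le\varphi_1(x_1)\vee\cdots\vee\varphi_\ell(x_\ell)$ in $\mathrm{Kr}_\ell(L)$. The ring $R$ is of Krull dimension $\le\ell-1$ if the lattice $\mathrm{Zar}(R)$ is of dimension $\le\ell-1$. *)

(* Defs.v *)
From HB Require Import structures.
From mathcomp Require Import all_boot all_order all_algebra.
From mathcomp Require Import boolp classical_sets.

Set Implicit Arguments.
Unset Strict Implicit.
Unset Printing Implicit Defensive.

Import Order.TTheory GRing.Theory.

(* Rings are [comPzRingType]s, so that the zero ring is allowed: it is the     *)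
(* only ring of Krull dimension <= -1.                                         *)

Section Ideals.
Local Open Scope ring_scope.
Variable R : comPzRingType.
Implicit Types (I J : set R) (s t : seq R).

Definition is_ideal I : Prop :=
  [/\ I 0, forall x y, I x -> I y -> I (x + y) & forall c x, I x -> I (c * x)].

Definition ideal_gen s : set R :=
  [set x | exists c : nat -> R, x = \sum_(i < size s) c i * s`_i]%classic.

Definition ideal_add I J : set R :=
  [set x | exists i j, [/\ I i, J j & x = i + j]]%classic.

Definition ideal_mul I J : set R :=
  [set x | exists2 r : seq (R * R), (forall p, p \in r -> I p.1 /\ J p.2)
                                  & x = \sum_(p <- r) p.1 * p.2]%classic.

Definition radical I : set R := [set x | exists n : nat, I (x ^+ n)]%classic.

Lemma ideal_sum I (T : Type) (r : seq T) (P : pred T) (F : T -> R) :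
  is_ideal I -> (forall i, P i -> I (F i)) -> I (\sum_(i <- r | P i) F i).
Proof. by case=> I0 ID _ IF; apply: (big_ind I). Qed.

Lemma ideal_gen_ideal s : is_ideal (ideal_gen s).
Proof.
split.
- by exists (fun=> 0); rewrite big1 // => i _; rewrite mul0r.
- move=> x y [c ->] [d ->]; exists (fun i => c i + d i).
  by rewrite -big_split; apply: eq_bigr => i _; rewrite mulrDl.
- move=> a x [c ->]; exists (fun i => a * c i).
  by rewrite mulr_sumr; apply: eq_bigr => i _; rewrite mulrA.
Qed.

Lemma mem_ideal_gen s x : x \in s -> ideal_gen s x.
Proof.
move=> sx; have sxs : (index x s < size s)%N by rewrite index_mem.
exists (fun i => (i == index x s)%:R).
rewrite (bigD1 (Ordinal sxs)) //= eqxx mul1r nth_index // big1 ?addr0 //.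
by move=> i /negbTE; rewrite -val_eqE /= => ->; rewrite mul0r.
Qed.

Lemma ideal_gen_sub s I : is_ideal I -> (forall x, x \in s -> I x) ->
  (ideal_gen s `<=` I)%classic.
Proof.
move=> II sI _ [c ->]; apply: ideal_sum => // i _.
by case: II => _ _; apply; apply/sI/mem_nth.
Qed.

Lemma sub_radical I : (I `<=` radical I)%classic.
Proof. by move=> x Ix; exists 1%N. Qed.

Lemma radical_ideal I : is_ideal I -> is_ideal (radical I).
Proof.
move=> II; have [I0 ID IM] := II; split; first exact: sub_radical.
- move=> x y [n xn] [m ym]; exists (n + m)%N; rewrite exprDn.
  apply: ideal_sum => // i _; rewrite -mulr_natl; apply: (IM).
  have [mi|im] := leqP m i.
    by rewrite -(subnK mi) exprD mulrA; apply: (IM).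
  have -> : (n + m - i = m - i + n)%N.
    by move: (nat_of_ord i) im => k km; rewrite [RHS]addnC addnBA // ltnW.
  by rewrite exprD mulrC mulrA; apply: (IM).
- by move=> c x [n xn]; exists n; rewrite exprMn; apply: (IM).
Qed.

Lemma radicalK I x n : radical I (x ^+ n) -> radical I x.
Proof. by case=> m; rewrite -exprM; exists (n * m)%N. Qed.

Lemma ideal_add_ideal I J : is_ideal I -> is_ideal J -> is_ideal (ideal_add I J).
Proof.
case=> I0 ID IM [J0 JD JM]; split.
- by exists 0, 0; rewrite addr0.
- move=> _ _ [i [j [Ii Jj ->]]] [i' [j' [Ii' Jj' ->]]].
  by exists (i + i'), (j + j'); rewrite addrACA; split; [exact: ID|exact: JD|].
- move=> c _ [i [j [Ii Jj ->]]].
  by exists (c * i), (c * j); rewrite mulrDr; split; [exact: IM|exact: JM|].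
Qed.

Lemma ideal_mul_ideal I J : is_ideal I -> is_ideal J -> is_ideal (ideal_mul I J).
Proof.
move=> [_ _ IM] _; split.
- by exists [::]; rewrite ?big_nil.
- move=> _ _ [r rIJ ->] [r' rIJ' ->]; exists (r ++ r'); rewrite ?big_cat //.
  by move=> p; rewrite mem_cat => /orP[/rIJ|/rIJ'].
- move=> c _ [r rIJ ->]; exists [seq (c * p.1, p.2) | p <- r].
    by move=> _ /mapP[p /rIJ[Ip Jp] ->]; split=> //; apply: IM.
  by rewrite big_map mulr_sumr; apply: eq_bigr => p _; rewrite mulrA.
Qed.

Lemma ideal_mul_sub I J K : is_ideal K ->
  (forall x y, I x -> J y -> K (x * y)) -> (ideal_mul I J `<=` K)%classic.
Proof.
move=> II IJK _ [r rIJ ->]; rewrite big_seq; apply: ideal_sum => // p.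
by move=> /rIJ[]; apply: IJK.
Qed.

Lemma ideal_mul_gen s t :
  ideal_mul (ideal_gen s) (ideal_gen t) = ideal_gen [seq x * y | x <- s, y <- t].
Proof.
have Ks := ideal_gen_ideal s; have Kt := ideal_gen_ideal t.
have K := ideal_gen_ideal [seq x * y | x <- s, y <- t].
case: (K) => K0 KD KM; apply/seteqP; split.
  apply: ideal_mul_sub => // _ _ [c ->] [d ->].
  rewrite big_distrlr; apply: ideal_sum => // i _; apply: ideal_sum => // j _ /=.
  by rewrite mulrACA; apply/KM/mem_ideal_gen/allpairs_f; apply: mem_nth.
apply: ideal_gen_sub => [|_ /allpairsP[[x y] [/= sx ty ->]]].
  exact: ideal_mul_ideal.
exists [:: (x, y)]; last by rewrite big_seq1.
by move=> _ /[!inE] /eqP ->; split; apply: mem_ideal_gen.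
Qed.

Lemma ideal_add_gen s t :
  ideal_add (ideal_gen s) (ideal_gen t) = ideal_gen (s ++ t).
Proof.
have Ks := ideal_gen_ideal s; have Kt := ideal_gen_ideal t.
have K := ideal_gen_ideal (s ++ t).
case: (K) => K0 KD KM; apply/seteqP; split.
  move=> _ [i [j [si tj ->]]]; apply: KD.
    by move: i si; apply: ideal_gen_sub => // x sx; apply/mem_ideal_gen; rewrite mem_cat sx.
  move: j tj; apply: ideal_gen_sub => // x tx; apply/mem_ideal_gen.
  by rewrite mem_cat tx orbT.
apply: ideal_gen_sub => [|x]; first exact: ideal_add_ideal.
rewrite mem_cat => /orP[] /mem_ideal_gen xI.
  by exists x, 0; rewrite addr0; case: Kt.
by exists 0, x; rewrite add0r; case: Ks.
Qed.

End Ideals.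

Section Zariski.
Local Open Scope ring_scope.
Variable R : comPzRingType.

Record Zar : Type := MkZar {
  zar_set :> set R;
  zar_setP : exists s : seq R, zar_set = radical (ideal_gen s) }.

HB.instance Definition _ := gen_eqMixin Zar.
HB.instance Definition _ := gen_choiceMixin Zar.

Implicit Types (U V W : Zar) (s t : seq R).

Definition zar s : Zar := MkZar (ex_intro _ s erefl).

(* Some finite list of generators; [zar_meetE] and [zar_joinE] below show that *)
(* meet and join do not depend on the choice.                                  *)
Definition zar_gens U : seq R := sval (cid (zar_setP U)).

Definition zar_le U V : bool := `[< (U `<=` V)%classic >].
Definition zar_meet U V : Zar := zar [seq x * y | x <- zar_gens U, y <- zar_gens V].
Definition zar_join U V : Zar := zar (zar_gens U ++ zar_gens V).

Lemma zar_inj U V : (U : set R) = V -> U = V.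
Proof.
case: U V => [U PU] [V PV] /= eUV; rewrite eUV in PU *.
by congr MkZar; exact: Prop_irrelevance.
Qed.

Lemma zar_gensK U : zar (zar_gens U) = U.
Proof. by apply/zar_inj; rewrite /zar_gens /=; case: cid. Qed.

Lemma zar_ideal U : is_ideal U.
Proof. by case: U => _ /= [s ->]; apply/radical_ideal/ideal_gen_ideal. Qed.

Lemma zar_rad U x n : zar_set U (x ^+ n) -> zar_set U x.
Proof. by case: U => _ /= [s ->]; exact: radicalK. Qed.

Lemma zar_sub s U : (forall x, x \in s -> zar_set U x) -> (zar s `<=` U)%classic.
Proof.
move=> sU x [n xn]; apply: (@zar_rad _ _ n); move: xn.
exact: (ideal_gen_sub (zar_ideal U)).
Qed.

Lemma mem_zar s x : x \in s -> zar_set (zar s) x.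
Proof. by move=> sx; apply/sub_radical/mem_ideal_gen. Qed.

Lemma mem_zar_gens U x : x \in zar_gens U -> zar_set U x.
Proof. by rewrite -{2}(zar_gensK U); exact: mem_zar. Qed.

Lemma zar_meet_set U V : (zar_meet U V : set R) = (U `&` V)%classic.
Proof.
have [_ _ UM] := zar_ideal U; have [_ _ VM] := zar_ideal V.
apply/seteqP; split.
  move=> x xUV; split; move: x xUV;
    apply: zar_sub => _ /allpairsP[[x y] [/= /mem_zar_gens Ux /mem_zar_gens Vy ->]].
    by rewrite mulrC; apply: UM.
  exact: VM.
move=> x [Ux Vx]; rewrite -(zar_gensK U) in Ux; rewrite -(zar_gensK V) in Vx.
case: Ux Vx => [n xn] [m xm]; exists (n + m)%N.
rewrite -ideal_mul_gen exprD; exists [:: (x ^+ n, x ^+ m)]; last by rewrite big_seq1.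
by move=> _ /[!inE] /eqP ->.
Qed.

Fact zar_le_refl : reflexive zar_le.
Proof. by move=> U; apply/asboolP. Qed.

Fact zar_le_anti : antisymmetric zar_le.
Proof.
by move=> U V /andP[/asboolP UV /asboolP VU]; apply/zar_inj/seteqP; split.
Qed.

Fact zar_le_trans : transitive zar_le.
Proof.
move=> V U W /asboolP UV /asboolP VW.
by apply/asboolP; apply: subset_trans UV VW.
Qed.

Fact zar_display : Order.disp_t. Proof. exact: Order.Disp tt tt. Qed.

HB.instance Definition _ :=
  Order.Le_isPOrder.Build zar_display Zar zar_le_refl zar_le_anti zar_le_trans.

Fact zar_meetP U V W : (U <= zar_meet V W)%O = (U <= V)%O && (U <= W)%O.
Proof.
apply/asboolP/andP; rewrite zar_meet_set subsetI.
  by move=> [UV UW]; split; apply/asboolP.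
by move=> [/asboolP UV /asboolP UW].
Qed.

Fact zar_joinP U V W : (zar_join U V <= W)%O = (U <= W)%O && (V <= W)%O.
Proof.
apply/asboolP/andP => [UVW|[/asboolP UW /asboolP VW]].
  by split; apply/asboolP; apply: subset_trans UVW;
    rewrite -[X in (zar_set X `<=` _)%classic]zar_gensK;
    apply: zar_sub => x gx; apply: mem_zar; rewrite mem_cat gx ?orbT.
by apply: zar_sub => x; rewrite mem_cat => /orP[] /mem_zar_gens; [exact: UW|exact: VW].
Qed.

HB.instance Definition _ :=
  Order.POrder_MeetJoin_isLattice.Build zar_display Zar zar_meetP zar_joinP.

Fact zar_meetUl : @left_distributive Zar Zar Order.meet Order.join.
Proof.
move=> U V W; apply/le_anti/andP; split; last first.
  by rewrite leUx !lexI !leIr !andbT !leIxl ?leUl ?leUr.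
have [_ D M] := zar_ideal (U `&` W `|` V `&` W)%O.
have sub1 : (U `&` W <= U `&` W `|` V `&` W)%O by exact: leUl.
have sub2 : (V `&` W <= U `&` W `|` V `&` W)%O by exact: leUr.
move/asboolP: sub1 => sub1; move/asboolP: sub2 => sub2; apply/asboolP.
rewrite zar_meet_set => x [[n]]; rewrite -ideal_add_gen => -[i [j [Ui Vj xn]]] Wx.
have [_ _ WM] := zar_ideal W; have [_ _ UM] := zar_ideal U.
have [_ _ VM] := zar_ideal V.
apply: (@zar_rad _ _ n.+1); rewrite exprSr xn mulrDl; apply: D.
  apply: sub1; rewrite zar_meet_set; split; last exact: WM.
  by rewrite mulrC; apply: UM; rewrite -(zar_gensK U); apply: sub_radical.
apply: sub2; rewrite zar_meet_set; split; last exact: WM.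
by rewrite mulrC; apply: VM; rewrite -(zar_gensK V); apply: sub_radical.
Qed.

HB.instance Definition _ :=
  Order.Lattice_Meet_isDistrLattice.Build zar_display Zar zar_meetUl.

Fact zar0x U : (zar [::] <= U)%O.
Proof. by apply/asboolP/zar_sub. Qed.

Fact zarx1 U : (U <= zar [:: 1])%O.
Proof.
apply/asboolP => x _; have [_ _ M] := zar_ideal (zar [:: 1]).
by rewrite -[x]mulr1; apply/M/mem_zar; rewrite inE.
Qed.

HB.instance Definition _ := Order.hasBottom.Build zar_display Zar zar0x.
HB.instance Definition _ := Order.hasTop.Build zar_display Zar zarx1.

Lemma zar_meetE s t :
  (zar s `&` zar t)%O = radical (ideal_mul (ideal_gen s) (ideal_gen t)) :> set R.
Proof.
rewrite zar_meet_set; have [_ _ IM] := zar_ideal (zar s).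
have [_ _ JM] := zar_ideal (zar t); rewrite ideal_mul_gen; apply/seteqP; split.
  move=> x [[n xn] [m xm]]; exists (n + m)%N; rewrite -ideal_mul_gen exprD.
  by exists [:: (x ^+ n, x ^+ m)]; rewrite ?big_seq1 // => _ /[!inE] /eqP ->.
move=> x xst; split; move: x xst;
  apply: (@zar_sub [seq x * y | x <- s, y <- t]) => _ /allpairsP[[x y]] [/= sx ty ->].
  by rewrite mulrC; apply/IM/mem_zar.
by apply/JM/mem_zar.
Qed.

Lemma zar_joinE s t :
  (zar s `|` zar t)%O = radical (ideal_add (ideal_gen s) (ideal_gen t)) :> set R.
Proof.
rewrite ideal_add_gen -[RHS]/(zar_set (zar (s ++ t))); congr zar_set.
have leP' u U : (zar u <= U)%O <-> (forall x, x \in u -> zar_set U x).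
  split=> [/asboolP uU x /mem_zar|uU]; first exact: uU.
  exact/asboolP/zar_sub.
apply/le_anti/andP; split.
  rewrite leUx; apply/andP; split; apply/leP' => x xs; apply/mem_zar;
  by rewrite mem_cat xs ?orbT.
have /asboolP sU : (zar s <= zar s `|` zar t)%O by exact: leUl.
have /asboolP tU : (zar t <= zar s `|` zar t)%O by exact: leUr.
by apply/leP' => x; rewrite mem_cat => /orP[] /mem_zar; [exact: sU|exact: tU].
Qed.

End Zariski.

(* Kr_l(L) is the quotient of the lattice terms in the generators phi_i(x) by  *)
(* the least distributive-lattice preorder that contains the relations.        *)

Section Kr.
Local Open Scope order_scope.
Variables (d : Order.disp_t) (L : tbDistrLatticeType d) (l : nat).

Inductive kr_term : Type :=
| KrGen of 'I_l.+1 & L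
| KrTop
| KrBot
| KrMeet of kr_term & kr_term
| KrJoin of kr_term & kr_term.

HB.instance Definition _ := gen_eqMixin kr_term.
HB.instance Definition _ := gen_choiceMixin kr_term.

(* [lift ord0 i] is i + 1 and [widen_ord _ i] is i, both in 'I_l.+1.           *)
Inductive kr_rel : kr_term -> kr_term -> Prop :=
| KrRel1 i : kr_rel KrTop (KrGen i \top)
| KrRel0 i : kr_rel (KrGen i \bot) KrBot
| KrRelI i a b : kr_rel (KrMeet (KrGen i a) (KrGen i b)) (KrGen i (a `&` b))
| KrRelU i a b : kr_rel (KrGen i (a `|` b)) (KrJoin (KrGen i a) (KrGen i b))
| KrRelLe i a b : a <= b -> kr_rel (KrGen i a) (KrGen i b)
| KrRelS (i : 'I_l) a :
    kr_rel (KrGen (lift ord0 i) a) (KrGen (widen_ord (leqnSn l) i) a).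

Inductive kr_le : kr_term -> kr_term -> Prop :=
| KrLeRel s t : kr_rel s t -> kr_le s t
| KrLeRefl s : kr_le s s
| KrLeTrans s t u : kr_le s t -> kr_le t u -> kr_le s u
| KrLeTop s : kr_le s KrTop
| KrLeBot s : kr_le KrBot s
| KrLeIl s t : kr_le (KrMeet s t) s
| KrLeIr s t : kr_le (KrMeet s t) t
| KrLeI s t u : kr_le u s -> kr_le u t -> kr_le u (KrMeet s t)
| KrLeUl s t : kr_le s (KrJoin s t)
| KrLeUr s t : kr_le t (KrJoin s t)
| KrLeU s t u : kr_le s u -> kr_le t u -> kr_le (KrJoin s t) u
| KrLeDistr s t u :
    kr_le (KrMeet (KrJoin s t) u) (KrJoin (KrMeet s u) (KrMeet t u)).

Definition kr_equiv (s t : kr_term) : bool := `[< kr_le s t /\ kr_le t s >].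

Fact kr_equiv_refl : reflexive kr_equiv.
Proof. by move=> s; apply/asboolP; split; exact: KrLeRefl. Qed.

Fact kr_equiv_sym : symmetric kr_equiv.
Proof. by move=> s t; apply/asboolP/asboolP => -[]. Qed.

Fact kr_equiv_trans : transitive kr_equiv.
Proof.
move=> t s u /asboolP[st ts] /asboolP[tu ut]; apply/asboolP; split.
  exact: KrLeTrans tu.
exact: KrLeTrans ts.
Qed.

Canonical kr_equiv_rel :=
  EquivRel kr_equiv kr_equiv_refl kr_equiv_sym kr_equiv_trans.

Definition Kr : Type := {eq_quot kr_equiv_rel}%qT.

HB.instance Definition _ := Choice.on Kr.

Implicit Types (p q r : Kr) (s t : kr_term).

Definition kr_class s : Kr := (\pi_({eq_quot kr_equiv_rel}) s)%qT.
Definition kr_repr p : kr_term := repr (p : {eq_quot kr_equiv_rel}%qT).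

Definition kr_phi (i : 'I_l.+1) (a : L) : Kr := kr_class (KrGen i a).

Definition kr_leq p q : bool := `[< kr_le (kr_repr p) (kr_repr q) >].
Definition kr_meet p q : Kr := kr_class (KrMeet (kr_repr p) (kr_repr q)).
Definition kr_join p q : Kr := kr_class (KrJoin (kr_repr p) (kr_repr q)).

Lemma kr_reprK p : kr_class (kr_repr p) = p.
Proof. exact: reprK. Qed.

Lemma kr_classK s : kr_le (kr_repr (kr_class s)) s /\ kr_le s (kr_repr (kr_class s)).
Proof.
have /eqquotP : kr_class (kr_repr (kr_class s)) = kr_class s
  by rewrite kr_reprK.
by move/asboolP.
Qed.

Lemma kr_leqP s t : reflect (kr_le s t) (kr_leq (kr_class s) (kr_class t)).
Proof.
have [s1 s2] := kr_classK s; have [t1 t2] := kr_classK t.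
apply: (iffP (asboolP _)) => st.
  exact: KrLeTrans s2 (KrLeTrans st t1).
exact: KrLeTrans s1 (KrLeTrans st t2).
Qed.

Lemma kr_classP p : exists s, p = kr_class s.
Proof. by exists (kr_repr p); rewrite kr_reprK. Qed.

Fact kr_leq_refl : reflexive kr_leq.
Proof. by move=> p; apply/asboolP; exact: KrLeRefl. Qed.

Fact kr_leq_anti : antisymmetric kr_leq.
Proof.
move=> p q /andP[/asboolP pq /asboolP qp].
by rewrite -(kr_reprK p) -(kr_reprK q); apply/eqquotP/asboolP.
Qed.

Fact kr_leq_trans : transitive kr_leq.
Proof.
by move=> q p r /asboolP pq /asboolP qr; apply/asboolP; exact: KrLeTrans qr.
Qed.

Fact kr_display : Order.disp_t. Proof. exact: Order.Disp tt tt. Qed.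

HB.instance Definition _ :=
  Order.Le_isPOrder.Build kr_display Kr kr_leq_refl kr_leq_anti kr_leq_trans.

Lemma kr_leP s t : reflect (kr_le s t) (kr_class s <= kr_class t).
Proof. exact: kr_leqP. Qed.

Fact kr_meetP p q r : (p <= kr_meet q r) = (p <= q) && (p <= r).
Proof.
rewrite -{1 2 3}(kr_reprK p) -{2}(kr_reprK q) -{2}(kr_reprK r).
apply/kr_leP/andP => [pqr|[/kr_leP pq /kr_leP pr]]; last exact: KrLeI.
by split; apply/kr_leP; apply: (KrLeTrans pqr); [exact: KrLeIl|exact: KrLeIr].
Qed.

Fact kr_joinP p q r : (kr_join p q <= r) = (p <= r) && (q <= r).
Proof.
rewrite -{1 2 3}(kr_reprK r) -{2}(kr_reprK p) -{2}(kr_reprK q).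
apply/kr_leP/andP => [pqr|[/kr_leP pr /kr_leP qr]]; last exact: KrLeU.
by split; apply/kr_leP; apply: KrLeTrans pqr; [exact: KrLeUl|exact: KrLeUr].
Qed.

HB.instance Definition _ :=
  Order.POrder_MeetJoin_isLattice.Build kr_display Kr kr_meetP kr_joinP.

Lemma kr_class_meet s t : kr_class (KrMeet s t) = kr_class s `&` kr_class t.
Proof.
apply/le_anti; rewrite lexI; apply/andP; split.
  by apply/andP; split; apply/kr_leP; [exact: KrLeIl|exact: KrLeIr].
have [u eu] := kr_classP (kr_class s `&` kr_class t).
rewrite eu; apply/kr_leP/KrLeI; apply/kr_leP; rewrite -eu; [exact: leIl|exact: leIr].
Qed.

Lemma kr_class_join s t : kr_class (KrJoin s t) = kr_class s `|` kr_class t.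
Proof.
apply/le_anti; rewrite leUx andbC; apply/andP; split.
  by apply/andP; split; apply/kr_leP; [exact: KrLeUl|exact: KrLeUr].
have [u eu] := kr_classP (kr_class s `|` kr_class t).
rewrite eu; apply/kr_leP/KrLeU; apply/kr_leP; rewrite -eu; [exact: leUl|exact: leUr].
Qed.

Fact kr_meetUl : @left_distributive Kr Kr Order.meet Order.join.
Proof.
move=> p q r; apply/le_anti/andP; split; last first.
  by rewrite leUx !lexI !leIr !andbT !leIxl ?leUl ?leUr.
have [s ->] := kr_classP p; have [t ->] := kr_classP q; have [u ->] := kr_classP r.
rewrite -(kr_class_join s t) -(kr_class_meet s u) -(kr_class_meet t u).
rewrite -(kr_class_meet (KrJoin s t)) -(kr_class_join (KrMeet s u)).
exact/kr_leP/KrLeDistr.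
Qed.

HB.instance Definition _ :=
  Order.Lattice_Meet_isDistrLattice.Build kr_display Kr kr_meetUl.

Fact kr0x p : kr_class KrBot <= p.
Proof. by have [s ->] := kr_classP p; apply/kr_leP/KrLeBot. Qed.

Fact krx1 p : p <= kr_class KrTop.
Proof. by have [s ->] := kr_classP p; apply/kr_leP/KrLeTop. Qed.

HB.instance Definition _ := Order.hasBottom.Build kr_display Kr kr0x.
HB.instance Definition _ := Order.hasTop.Build kr_display Kr krx1.

(* Universal property: a family in a bounded distributive lattice M that       *)
(* satisfies the relations induces a monotone map from Kr_l(L) to M.           *)
Fixpoint kr_eval d' (M : tbDistrLatticeType d') (f : 'I_l.+1 -> L -> M)
    (s : kr_term) : M :=
  match s with
  | KrGen i a => f i a
  | KrTop => \top
  | KrBot => \bot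
  | KrMeet s t => kr_eval f s `&` kr_eval f t
  | KrJoin s t => kr_eval f s `|` kr_eval f t
  end.

Lemma kr_le_eval d' (M : tbDistrLatticeType d') (f : 'I_l.+1 -> L -> M) s t :
  (forall u v, kr_rel u v -> kr_eval f u <= kr_eval f v) ->
  kr_class s <= kr_class t -> kr_eval f s <= kr_eval f t.
Proof.
move=> frel /kr_leP; elim=> /=.
- exact: frel.
- by [].
- by move=> u v w _ uv _; apply: le_trans.
- by move=> u; apply: lex1.
- by move=> u; apply: le0x.
- by move=> u v; apply: leIl.
- by move=> u v; apply: leIr.
- by move=> u v w _ wu _ wv; rewrite lexI wu.
- by move=> u v; apply: leUl.
- by move=> u v; apply: leUr.
- by move=> u v w _ uw _ vw; rewrite leUx uw.
- by move=> u v w; rewrite meetUl.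
Qed.

End Kr.

(* [lattice_dim_lt L l] and [krull_dim_lt R l] mean dimension <= l - 1. The    *)
(* sequence x_1, ..., x_l is indexed from 0: [x i] is x_(i + 1).               *)

Definition lattice_dim_lt d (L : tbDistrLatticeType d) (l : nat) : Prop :=
  forall x : 'I_l -> L,
    (\meet_(i < l) kr_phi (widen_ord (leqnSn l) i) (x i)
       <= \join_(i < l) kr_phi (lift ord0 i) (x i))%O.

Definition krull_dim_lt (R : comPzRingType) (l : nat) : Prop :=
  lattice_dim_lt (Zar R) l.

(* t_1; the right fold makes the last index the innermost one.                 *)
Definition collapse (R : comPzRingType) (l : nat) (x a : 'I_l -> R)
    (m : 'I_l -> nat) : R :=
  foldr (fun k t => x k ^+ m k * (t + a k * x k))%R 1%R (enum 'I_l).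

(* Main.v *)
Require Import Defs.
From mathcomp Require Import all_boot all_order all_algebra.
From mathcomp Require Import boolp classical_sets.

Set Implicit Arguments.
Unset Strict Implicit.
Unset Printing Implicit Defensive.

Import Order.TTheory GRing.Theory.

(** Write D(x) for the radical of the ideal (x).

    If t_1 = 0, put c_k = phi_k(D(t_(k+1))) for 0 <= k <= l, so that c_l = 1
    and c_0 = phi_0(D(0)) = 0. The identity t_k = x_k^(m_k) (t_(k+1) + a_k x_k)
    says exactly that one can pass from c_k to c_(k-1) at the cost of meeting
    with phi_(k-1)(D(x_k)) and joining with phi_k(D(x_k)) (kr_step); chaining
    these cuts from c_l down to c_0 (cut_chain) gives the dimension inequality
    for the D(x_k). An arbitrary element of Zar(R) is a finite join of such
    D(x), and the phi_i preserve finite joins, so distributivity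
    (meet_join_le) extends the inequality to the whole lattice.

    For the converse, suppose that x_1, ..., x_l admits no collapse. Every
    increasing chain of primes p_0, ..., p_l interprets Kr_l(Zar(R)) in the
    two-element lattice, phi_i(U) being true when U is not contained in p_i
    (outside_kr_rel). Under this reading, a chain such that x_k lies in p_k
    but not in p_(k-1) violates the dimension inequality. To obtain such a
    chain, consider for each k the possible values S_k of t_k: a
    multiplicative set with S_(l+1) = {1}. Since S_1 misses the ideal 0, there
    is a prime p_0 missing S_1. The shape of S_k is what makes the
    construction continue: if a prime p_(k-1) misses S_k, then it does not
    contain x_k, and p_(k-1) + (x_k) still misses S_(k+1), so it is contained
    in a prime p_k missing S_(k+1) (prime_chain). *)

(** * Cuts and distributivity in a distributive lattice *)

Section DistributiveLattices.
Local Open Scope order_scope.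
Variables (d : Order.disp_t) (L : tbDistrLatticeType d).

(** Each hypothesis is a sequent c_(i+1), u_i |- c_i, v_i; cutting successively
    on c_(n-1), ..., c_1 leaves only the two extreme c's. *)
Lemma cut_chain n (c : nat -> L) (u v : 'I_n -> L) :
  (forall i : 'I_n, c i.+1 `&` u i <= c i `|` v i) ->
  c n `&` \meet_(i < n) u i <= c 0 `|` \join_(i < n) v i.
Proof.
elim: n u v => [|n IHn] u v cuv; first by rewrite leIxl // leUl.
rewrite !big_ord_recr /=.
set U := \meet_(i < n) _; set V := \join_(i < n) _.
have cUV : c n `&` U <= c 0 `|` V.
  by apply: IHn => i; exact: (cuv (widen_ord (leqnSn n) i)).
rewrite [U `&` _]meetC meetA.
apply: (le_trans (leI2 (cuv ord_max) (lexx U))).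
rewrite meetUl joinA leUx; apply/andP; split; first by rewrite lexU2 ?cUV.
by rewrite leIxl // leUr.
Qed.

(** Distributing a meet of joins gives the join, over all choices x of one
    entry in each S i, of the meets of the u i (x i). The parameter c absorbs,
    in the induction, the factors whose choice has already been made, and y0 fills the choice
    function outside r. *)
Lemma meet_join_le (I T : eqType) (y0 : T) (r : seq I) (S : I -> seq T) (u : I -> T -> L)
    (b c : L) : uniq r ->
  (forall x : I -> T, (forall i, i \in r -> x i \in S i) ->
     c `&` \meet_(i <- r) u i (x i) <= b) ->
  c `&` \meet_(i <- r) \join_(y <- S i) u i y <= b.
Proof.
elim: r c => [|i r IHr] c /= => [_ ub|/andP[ri ur] ub].
  by have := ub (fun=> y0); rewrite !big_nil; apply.
rewrite big_cons meetA meetC (big_endo (Order.meet c) (meetUr c) (meetx0 c)).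
set m := \meet_(_ <- r) _; rewrite (big_endo (Order.meet m) (meetUr m) (meetx0 m)).
rewrite {}/m; apply/joinsP_seq => y yS _; rewrite meetC; apply: IHr => // x xS.
pose x' j := if j == i then y else x j.
have := ub x'; rewrite big_cons [x' i]/x' eqxx meetA.
rewrite (eq_big_seq (fun j => u j (x j))); last first.
  by rewrite /x' => j jr; case: eqP jr => // ->; rewrite (negPf ri).
apply=> j; rewrite inE /x'; case: eqP => [-> //|_] /=; exact: xS.
Qed.

End DistributiveLattices.

(** * The generators of the Krull lattice *)

Section KrPhi.
Local Open Scope order_scope.
Variables (d : Order.disp_t) (L : tbDistrLatticeType d) (l : nat).
Implicit Types (i : 'I_l.+1) (a b : L).

Lemma kr_phi1 i : kr_phi i \top = \top :> Kr L l.
Proof. by apply/le_anti; rewrite lex1; apply/kr_leP/KrLeRel/KrRel1. Qed.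

Lemma kr_phi0 i : kr_phi i \bot = \bot :> Kr L l.
Proof. by apply/le_anti; rewrite le0x andbT; apply/kr_leP/KrLeRel/KrRel0. Qed.

Lemma kr_phi_le i a b : a <= b -> kr_phi i a <= kr_phi i b.
Proof. by move=> ab; apply/kr_leP/KrLeRel/KrRelLe. Qed.

Lemma kr_phiI i a b : kr_phi i (a `&` b) = kr_phi i a `&` kr_phi i b.
Proof.
apply/le_anti; rewrite lexI !kr_phi_le ?leIl ?leIr //=.
by rewrite -kr_class_meet; apply/kr_leP/KrLeRel/KrRelI.
Qed.

Lemma kr_phiU i a b : kr_phi i (a `|` b) = kr_phi i a `|` kr_phi i b.
Proof.
apply/le_anti; rewrite leUx !kr_phi_le ?leUl ?leUr //= andbT.
by rewrite -kr_class_join; apply/kr_leP/KrLeRel/KrRelU.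
Qed.

Lemma kr_phi_succ (i : 'I_l) a :
  kr_phi (lift ord0 i) a <= kr_phi (widen_ord (leqnSn l) i) a.
Proof. by apply/kr_leP/KrLeRel/KrRelS. Qed.

Lemma kr_phi_join (T : Type) i (r : seq T) (F : T -> L) :
  kr_phi i (\join_(y <- r) F y) = \join_(y <- r) kr_phi i (F y).
Proof. exact: (big_morph _ (kr_phiU i) (kr_phi0 i)). Qed.

(** The universal property of Kr, stated for the only elements that the
    definition of dimension compares. *)
Lemma kr_le_eval_big d' (M : tbDistrLatticeType d') (f : 'I_l.+1 -> L -> M)
    (I : Type) (r : seq I) (g h : I -> 'I_l.+1) (x : I -> L) :
  (forall s t, kr_rel s t -> kr_eval f s <= kr_eval f t) ->
  \meet_(i <- r) kr_phi (g i) (x i) <= \join_(i <- r) kr_phi (h i) (x i) ->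
  \meet_(i <- r) f (g i) (x i) <= \join_(i <- r) f (h i) (x i).
Proof.
move=> frel.
rewrite -(big_morph _ (@kr_class_meet _ L l) (erefl : kr_class (KrTop _ _) = \top)).
rewrite -(big_morph _ (@kr_class_join _ L l) (erefl : kr_class (KrBot _ _) = \bot)).
move/(kr_le_eval frel).
rewrite (big_morph (kr_eval f) (id1 := \top) (op1 := Order.meet)) //.
by rewrite (big_morph (kr_eval f) (id1 := \bot) (op1 := Order.join)).
Qed.

End KrPhi.

(** * From collapses to the dimension inequality *)

Section CollapseToDimension.
Local Open Scope ring_scope.
Variable R : comPzRingType.
Implicit Types (x y : R).

Definition zarD x : Zar R := zar [:: x].

Lemma zarD_le x (U : Zar R) : zar_set U x -> (zarD x <= U)%O.
Proof. by move=> Ux; apply/asboolP/zar_sub => y /[!inE] /eqP ->. Qed.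

Lemma zarD0 : zarD 0 = \bot%O.
Proof.
by apply/le_anti; rewrite le0x andbT; apply: zarD_le; case: (zar_ideal (\bot%O : Zar R)).
Qed.

Lemma zarDM x y : (zarD x `&` zarD y <= zarD (x * y))%O.
Proof.
by apply/asboolP; rewrite zar_meetE ideal_mul_gen.
Qed.

Lemma zarDD x y : (zarD (x + y) <= zarD x `|` zarD y)%O.
Proof.
apply: zarD_le; rewrite zar_joinE ideal_add_gen; apply/sub_radical.
have [_ ID _] := ideal_gen_ideal [:: x; y].
by apply: ID; apply: mem_ideal_gen; rewrite !inE eqxx ?orbT.
Qed.

Lemma zarDX x n : (zarD x <= zarD (x ^+ n))%O.
Proof. by apply: zarD_le; apply: (@zar_rad _ _ _ n); apply: mem_zar; rewrite inE. Qed.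

Lemma zarDMl a x : (zarD (a * x) <= zarD x)%O.
Proof.
by apply: zarD_le; have [_ _] := zar_ideal (zarD x); apply; apply: mem_zar; rewrite inE.
Qed.

Lemma zar_joins (U : Zar R) : U = (\join_(x <- zar_gens U) zarD x)%O.
Proof.
apply/le_anti/andP; split; last first.
  by apply/joinsP_seq => x xU _; apply/zarD_le/mem_zar_gens.
rewrite -{1}(zar_gensK U); apply/asboolP/zar_sub => x xU.
have /asboolP := @joins_sup_seq _ (Zar R) _ _ predT zarD x xU isT.
by apply; apply: mem_zar; rewrite inE.
Qed.

(** One cut of the chain. From t = (t + a x) - a x, D(t) is below
    D(t + a x) \/ D(x). The second part stays at level i + 1, on the right; the
    first is moved down to level i, where it is met with D(x), which lies below
    D(x^m). *)
Lemma kr_step l (i : 'I_l) (x a t : R) m :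
  (kr_phi (lift ord0 i) (zarD t) `&` kr_phi (widen_ord (leqnSn l) i) (zarD x) <=
   kr_phi (widen_ord (leqnSn l) i) (zarD (x ^+ m * (t + a * x)))
     `|` kr_phi (lift ord0 i) (zarD x))%O.
Proof.
have tx : (zarD t <= zarD (t + a * x) `|` zarD x)%O.
  rewrite -{1}[t](addrK (a * x)) -mulNr; apply: (le_trans (zarDD _ _)).
  by rewrite leU2 ?zarDMl.
apply: (le_trans (leI2 (kr_phi_le (lift ord0 i) tx) (lexx _))).
rewrite kr_phiU meetUl; apply: leU2; last exact: leIl.
apply: (le_trans (leI2 (kr_phi_succ i _) (lexx _))).
rewrite -kr_phiI; apply: kr_phi_le; rewrite meetC.
exact: le_trans (leI2 (zarDX x m) (lexx _)) (zarDM _ _).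
Qed.

Lemma collapse_kr_le l (x a : 'I_l -> R) m : collapse x a m = 0 ->
  (\meet_(i < l) kr_phi (widen_ord (leqnSn l) i) (zarD (x i)) <=
   \join_(i < l) kr_phi (lift ord0 i) (zarD (x i)))%O.
Proof.
(* The tail t k is t_(k+1): it still involves the last l - k elements. *)
pose t k := foldr (fun i t => x i ^+ m i * (t + a i * x i)) 1 (drop k (enum 'I_l)).
have tS (i : 'I_l) : t i = x i ^+ m i * (t i.+1 + a i * x i).
  by rewrite /t (drop_nth i) ?size_enum_ord // nth_ord_enum.
move=> t0; have {t0} : t 0%N = 0 by rewrite /t drop0.
have : t l = 1 by rewrite /t drop_oversize // size_enum_ord.
move=> tl t0.
have := @cut_chain _ (Kr (Zar R) l) l (fun k => kr_phi (inord k) (zarD (t k)))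
  (fun i => kr_phi (widen_ord (leqnSn l) i) (zarD (x i)))
  (fun i => kr_phi (lift ord0 i) (zarD (x i))).
rewrite tl t0 zarD0 kr_phi0 join0x (kr_phi1 (Zar R) (inord l)) meet1x; apply=> i.
have -> : inord i.+1 = lift ord0 i by apply: val_inj; rewrite /= inordK // ltnS.
have -> : inord i = widen_ord (leqnSn l) i.
  by apply: val_inj; rewrite /= inordK // ltnS ltnW.
by rewrite tS; apply: kr_step.
Qed.

Lemma exists_collapse_krull_dim_lt l :
  (forall x : 'I_l -> R, exists (a : 'I_l -> R) (m : 'I_l -> nat),
     collapse x a m = 0) -> krull_dim_lt R l.
Proof.
move=> xam U.
have phiE i j : kr_phi i (U j) =
    (\join_(y <- zar_gens (U j)) kr_phi i (zarD y))%O :> Kr (Zar R) l.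
  by rewrite {1}[U j]zar_joins kr_phi_join.
rewrite (eq_bigr _ (fun i _ => phiE _ i)).
rewrite -[X in (X <= _)%O]meet1x; apply: (meet_join_le (0 : R)).
- exact: index_enum_uniq.
- move=> x xU; have [a [m /collapse_kr_le]] := xam x.
  rewrite meet1x => /le_trans; apply; apply/joinsP => i _.
  apply: (@joins_min _ (Kr (Zar R) l) _ i) => //.
  rewrite phiE.
  exact: joins_sup_seq (xU i (mem_index_enum i)) isT.
Qed.

End CollapseToDimension.

(** * From the dimension inequality to collapses *)

Section PrimeChains.
Local Open Scope ring_scope.
Local Open Scope classical_set_scope.
Variable R : comPzRingType.
Implicit Types (P I S : set R) (x y : R).

Definition is_prime P : Prop :=
  [/\ is_ideal P, ~ P 1 & forall x y, P (x * y) -> P x \/ P y].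

Definition mult_set S : Prop := S 1 /\ forall x y, S x -> S y -> S (x * y).

Definition adjoin I x : set R := [set z | exists i c, I i /\ z = i + c * x].

Lemma adjoin_ideal I x : is_ideal I -> is_ideal (adjoin I x).
Proof.
case=> I0 ID IM; split.
- by exists 0, 0; rewrite mul0r addr0.
- move=> _ _ [i [c [Ii ->]]] [j [e [Ij ->]]]; exists (i + j), (c + e).
  by rewrite mulrDl addrACA; split=> //; apply: ID.
- move=> a _ [i [c [Ii ->]]]; exists (a * i), (a * c).
  by rewrite mulrDr mulrA; split=> //; apply: IM.
Qed.

Lemma sub_adjoin I x : I `<=` adjoin I x.
Proof. by move=> i Ii; exists i, 0; rewrite mul0r addr0. Qed.

Lemma adjoin_self I x : is_ideal I -> adjoin I x x.
Proof. by case=> I0 _ _; exists 0, 1; rewrite add0r mul1r. Qed.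

(** Krull's lemma: an ideal maximal among those that contain I and miss S is
    prime, for if x and y are outside it, then adjoining either one reaches S,
    and the product of the two elements of S so reached lies in the ideal as
    soon as x y does. *)
Lemma prime_avoiding I S : is_ideal I -> mult_set S ->
  (forall s, S s -> ~ I s) ->
  exists P, [/\ is_prime P, I `<=` P & forall s, S s -> ~ P s].
Proof.
move=> II [S1 SM] SI.
(* The union with I makes the empty chain admissible: its union, the empty set,
   then stands for I. *)
pose avoids X := is_ideal (X `|` I) /\ forall s, S s -> ~ (X `|` I) s.
have [F Fav Ftot|A [[AI AS] Amax]] := @Zorn_bigcup R avoids.
  split; last first.
    by move=> s Ss [[X FX Xs]|/(SI _ Ss)//]; case: (Fav X FX) => _ /(_ s Ss); apply; left.
  have [I0 ID IM] := II.
  have FD X x y : F X -> (X `|` I) x -> (X `|` I) y ->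
      (\bigcup_(X in F) X `|` I) (x + y).
    move=> FX Xx Xy; have [[_ XD _] _] := Fav X FX.
    by have [?|?] := XD _ _ Xx Xy; [left; exists X|right].
  split; first by right.
  - move=> x y [[X FX Xx]|Ix] [[Y FY Yy]|Iy]; last by right; apply: ID.
    + have [XY|YX] := Ftot X Y FX FY.
        by apply: (FD Y) => //; left=> //; apply: XY.
      by apply: (FD X) => //; left=> //; apply: YX.
    + by apply: (FD X) => //; [left|right].
    + by apply: (FD Y) => //; [right|left].
  - move=> c x [[X FX Xx]|Ix]; last by right; apply: IM.
    have [[_ _ XM] _] := Fav X FX.
    by have [] := XM c x (or_introl Xx); [left; exists X|right].
have [_ PD PM] := AI.
exists (A `|` I); split; [|by move=> x Ix; right|exact: AS].
split; [by []|exact: AS|move=> x y Pxy].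
have meets z : ~ (A `|` I) z -> exists2 s, S s & adjoin (A `|` I) z s.
  move=> Pz; apply: contrapT => nS.
  have sub : A `|` I `<=` adjoin (A `|` I) z by exact: sub_adjoin.
  apply: (Amax (adjoin (A `|` I) z)).
    split=> [w Aw|AB]; first by apply: sub; left.
    by apply: Pz; left; apply: AB; apply: adjoin_self.
  rewrite /avoids (_ : adjoin _ _ `|` I = adjoin (A `|` I) z).
    by split; [exact: adjoin_ideal|move=> s Ss As; apply: nS; exists s].
  by apply/seteqP; split=> [w [//|Iw]|w]; [apply: sub; right|left].
apply: contrapT => /not_orP[/meets[s Ss [p [c [Pp es]]]]].
move=> /meets[s' Ss' [p' [c' [Pp' es']]]].
apply: (AS (s * s')); first exact: SM.
rewrite es' mulrDr; apply: (PD); first exact: (PM).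
rewrite mulrCA; apply: (PM); rewrite es mulrDl; apply: (PD).
  by rewrite mulrC; apply: (PM).
by rewrite -mulrA; apply: (PM).
Qed.

(** The values that t_k can take for some choice of coefficients and exponents,
    xs being the sequence x_k, ..., x_l. *)
Fixpoint collapse_set (xs : seq R) : set R :=
  if xs is x :: xs' then
    [set y | exists s a m, collapse_set xs' s /\ y = x ^+ m * (s + a * x)]
  else [set 1].

Lemma collapse_set_mult xs : mult_set (collapse_set xs).
Proof.
elim: xs => [|x xs [S1 SM]] /=; first by split=> // _ _ -> ->; rewrite mulr1.
split; first by exists 1, 0, 0%N; rewrite mul0r addr0 mulr1.
move=> _ _ [s [a [m [Ss ->]]]] [s' [a' [m' [Ss' ->]]]].
exists (s * s'), (s * a' + a * (s' + a' * x)), (m + m')%N; split; first exact: SM.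
rewrite mulrACA -exprD mulrDl [s * (_ + _)]mulrDr [(_ + _ * (_ + _)) * x]mulrDl addrA.
by rewrite [s * (a' * x)]mulrA [a * (_ + _) * x]mulrAC.
Qed.

(** The induction replaces I by p 0 + (x), which misses the set of the tail: if
    s = q + c x with q in p 0, then q = x^0 (s + (- c) x) would be a value of
    the whole sequence. And x = x^1 (1 + 0 x) is such a value, hence is not in
    p 0. *)
Lemma prime_chain xs I : is_ideal I -> (forall s, collapse_set xs s -> ~ I s) ->
  exists p : nat -> set R,
    [/\ forall i, is_prime (p i), I `<=` p 0%N, forall i, p i `<=` p i.+1
      & forall i, (i < size xs)%N -> p i.+1 xs`_i /\ ~ p i xs`_i].
Proof.
elim: xs I => [|x xs IHxs] I II SI.
  have [P [PP IP _]] := prime_avoiding II (collapse_set_mult [::]) SI.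
  by exists (fun=> P); split=> // i y.
have [P [PP IP SP]] := prime_avoiding II (collapse_set_mult (x :: xs)) SI.
have [PI _ _] := PP; have [S1 _] := collapse_set_mult xs.
have [s Ss [q [c [Pq es]]]|p [pp Pp pS px]] := IHxs _ (adjoin_ideal x PI).
  apply: (SP q _ Pq).
  exists s, (- c), 0%N; split=> //.
  by rewrite mul1r es mulNr addrK.
exists (fun i => if i is j.+1 then p j else P); split=> //.
- by case.
- by case=> [|i]; [move=> y Py; apply: Pp; apply: sub_adjoin|apply: pS].
- case=> [_|i]; last exact: px.
  split; first by apply: Pp; apply: adjoin_self.
  apply: SP; exists 1, 0, 1%N; split=> //.
  by rewrite mul0r addr0 mulr1.
Qed.

Lemma prime_zar_sub P s : is_prime P -> (forall x, x \in s -> P x) -> zar s `<=` P.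
Proof.
move=> [PI P1 PM] sP x [n /(ideal_gen_sub PI sP)].
by elim: n => // n IHn; rewrite exprS => /PM[].
Qed.

(** The negation of the inclusion of U in P, that is, whether P belongs to the
    basic quasi-compact open set of the spectrum defined by U. *)
Definition outside P (U : Zar R) : bool := `[< exists2 x, zar_set U x & ~ P x >].

(** Each phi_i must become a lattice homomorphism, which is where primality of
    p i enters (notably for meets), and the relation between levels i + 1 and i is the
    inclusion of p i in p (i + 1). *)
Lemma outside_kr_rel l (p : nat -> set R) :
  (forall i, is_prime (p i)) -> (forall i, p i `<=` p i.+1) ->
  forall s t, kr_rel s t ->
    (kr_eval (fun i : 'I_l.+1 => outside (p i)) s <=
     kr_eval (fun i : 'I_l.+1 => outside (p i)) t)%O.
Proof.
move=> pp pS.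
have leb (b c : bool) : (b -> c) -> (b <= c)%O by case: b c => [] [] // /(_ isT).
have sub i s x : zar_set (zar s) x -> ~ p i x -> exists2 y, y \in s & ~ p i y.
  move=> sx px; apply: contrapT => ns; apply/px/(prime_zar_sub (pp i) _ sx) => y ys.
  by apply: contrapT => py; apply: ns; exists y.
move=> _ _ [i|i|i U V|i U V|i U V /asboolP UV|i U]; apply: leb => /=.
- by move=> _; apply/asboolP; exists 1; [apply/mem_zar/mem_head|case: (pp i)].
- by move=> /asboolP[x x0 /(sub i _ _ x0)[]].
- move=> /andP[/asboolP[x Ux px] /asboolP[y Vy py]]; apply/asboolP; exists (x * y).
    have [_ _ UM] := zar_ideal U; have [_ _ VM] := zar_ideal V.
    by rewrite zar_meet_set; split; [rewrite mulrC; apply: UM|apply: VM].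
  by have [_ _ PM] := pp i; case/PM.
- move=> /asboolP[x UVx /(sub i _ _ UVx)[y]]; rewrite mem_cat => /orP[] yU py.
    by apply/orP; left; apply/asboolP; exists y => //; apply: mem_zar_gens.
  by apply/orP; right; apply/asboolP; exists y => //; apply: mem_zar_gens.
- by move=> /asboolP[x /UV Vx px]; apply/asboolP; exists x.
- move=> /asboolP[x Ux px]; apply/asboolP; exists x => // px'.
  by apply/px/pS.
Qed.

(** The witnesses are assembled into functions of the index, which requires the
    indices to be distinct. *)
Lemma collapse_set_foldr (I : eqType) (r : seq I) (x : I -> R) y : uniq r ->
  collapse_set (map x r) y ->
  exists (a : I -> R) (m : I -> nat),
    foldr (fun k t => x k ^+ m k * (t + a k * x k)) 1 r = y.
Proof.
elim: r y => [|i r IHr] y /=; first by move=> _ ->; exists (fun=> 0), (fun=> 0%N).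
move=> /andP[ri /IHr{}IHr] [s [b [n [/IHr[a [m <-]] ->]]]].
exists (fun k => if k == i then b else a k), (fun k => if k == i then n else m k).
rewrite eqxx; congr (_ * (_ + _)).
elim: r ri {IHr} => //= k r IHr; rewrite inE negb_or eq_sym => /andP[/negPf-> ri].
by rewrite IHr.
Qed.

Lemma krull_dim_lt_exists_collapse l (x : 'I_l -> R) : krull_dim_lt R l ->
  exists (a : 'I_l -> R) (m : 'I_l -> nat), collapse x a m = 0.
Proof.
move=> dimR; apply: collapse_set_foldr; first exact: enum_uniq.
apply: contrapT => S0.
have I0 : is_ideal ([set 0] : set R).
  by split=> // [_ _ -> ->|c _ ->]; rewrite ?addr0 ?mulr0.
have [s Ss s0|p [pp _ pS px]] := @prime_chain (map x (enum 'I_l)) [set 0] I0.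
  by apply: S0; rewrite -[0]s0.
have {}px (i : 'I_l) : p i.+1 (x i) /\ ~ p i (x i).
  have := px i; rewrite size_map size_enum_ord => /(_ (ltn_ord i)).
  by rewrite (nth_map i) ?size_enum_ord // nth_ord_enum.
have := kr_le_eval_big (outside_kr_rel pp pS) (dimR (fun i => zarD (x i))).
suff [-> ->] : (\meet_(i < l) outside (p i) (zarD (x i)) = \top /\
     \join_(i < l) outside (p i.+1) (zarD (x i)) = \bot)%O by [].
split; rewrite big1 // => i _.
  apply/asboolP; exists (x i); first exact/mem_zar/mem_head.
  by case: (px i).
apply/negbTE/asboolPn => -[y xy]; apply.
apply: (prime_zar_sub _ _ xy) => // z; rewrite inE => /eqP ->.
by case: (px i).
Qed.

End PrimeChains.

Theorem corollary3p6 (R : comPzRingType) (l : nat) :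
  krull_dim_lt R l <->
  (forall x : 'I_l -> R, exists (a : 'I_l -> R) (m : 'I_l -> nat),
     collapse x a m = 0%R).
Proof.
split=> [dimR x|]; first exact: krull_dim_lt_exists_collapse.
exact: exists_collapse_krull_dim_lt.
Qed.
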